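(* Let $\lambda$ be an uncountable cardinal and let $F$ be a field. Then there exists an $F$-algebra $R$ such that for any regular uncountable cardinal $\kappa\leq\lambda$ and any $i\in B(\kappa)$ there is a strongly uniform module $I\in\mathrm{Zg}(R)$ (of dimension $\kappa$) such that $\Gamma^*(I)$ is defined and $\Gamma^*(I)=i$.
   Context: Rings are associative with unit; modules are unitary right modules. $\mathrm{Zg}(R)$, the Ziegler spectrum of $R$, has as points the (isomorphism classes of) indecomposable pure-injective right $R$-modules (only the point set is relevant here). For a regular uncountable cardinal $\kappa$, $B(\kappa)$ is the Boolean algebra of subsets of $\kappa$ modulo the club filter: for $E\subseteq\kappa$, $\overline{E}$ is the class of all $D\subseteq\kappa$ with $D\cap C=E\cap C$ for some closed unbounded $C\subseteq\kappa$; $\overline{D}\le\overline{E}$ iff $D\cap C\subseteq E$ for some closed unbounded $C$. Let $U$ be a module. A c.d.c. of length $\kappa$ ($\kappa$ an ordinal) in $U$ is a sequence $\mathcal U=(U_\alpha\mid\alpha<\kappa)$ of non-zero submodules of $U$ that is continuous ($U_0=U$, and $U_\alpha=\bigcap_{\beta<\alpha}U_\beta$ for limit $\alpha<\kappa$), strictly decreasing ($U_{\alpha+1}\subsetneq U_\alpha$), and cofinal (each non-zero submodule of $U$ contains some $U_\alpha$). $U$ is strongly uniform if there is a c.d.c. in $U$; the dimension of $U$ is the least length of a c.d.c. in $U$. For submodules $0\ne V\subsetneq W\subseteq U$, $W$ is complemented over $V$ (in $U$) if there is a submodule $X\subseteq U$ with $W\cap X=V$ and $W+X=U$. If $U$ is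 strongly uniform of dimension $\kappa$, a regular uncountable cardinal, and $\mathcal U=(U_\alpha\mid\alpha<\kappa)$ is a c.d.c. in $U$, put $E_{\mathcal U}=\{\alpha<\kappa\mid \exists\beta:\ \alpha<\beta<\kappa$ and $U_\alpha$ is not complemented over $U_\beta\}$ and $\Gamma(U)=\overline{E_{\mathcal U}}\in B(\kappa)$; this does not depend on the choice of $\mathcal U$ (known fact). Non-zero submodules of $U$ are again strongly uniform of dimension $\kappa$. Put $\mathcal G(U)=\{\Gamma(V)\mid 0\neq V\subseteq U\}\subseteq B(\kappa)$. If $\mathcal G(U)$ has a least element, define $\Gamma^*(U)=\min\mathcal G(U)$; otherwise $\Gamma^*(U)$ is not defined. *)

(* Defs.v *)
From mathcomp Require Import all_boot all_order all_algebra.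
From mathcomp Require Import boolp classical_sets functions cardinality.
From mathcomp Require Import wochoice.

Set Implicit Arguments.
Unset Strict Implicit.
Unset Printing Implicit Defensive.

Import Order.TTheory GRing.Theory.
Local Open Scope classical_set_scope.
Local Open Scope card_scope.
Local Open Scope ring_scope.

(* Ordinals are well-ordered orderTypes K, identified with {a | a < K}; an
   (initial) cardinal K is compared with an arbitrary cardinal, i.e. with a
   bare type L, by [set: K] #<= [set: L].                                     *)
Section Ordinals.
Variables (d : Order.disp_t) (K : orderType d).
Implicit Types (a b x : K) (C D E : set K).

Definition is_ordinal : Prop := well_order (<=%O : rel K).

Definition is_zero a : Prop := forall x, (a <= x)%O.

Definition is_succ a b : Prop := (a < b)%O /\ forall x, (a < x)%O -> (b <= x)%O.

Definition is_limit b : Prop := ~ is_zero b /\ forall a, ~ is_succ a b.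

Definition unbounded C : Prop := forall a, exists2 b, C b & (a <= b)%O.

Definition initial_ordinal : Prop :=
  forall a, ~ ([set: K] #<= [set x | (x < a)%O]).

Definition regular_uncountable_cardinal : Prop :=
  [/\ is_ordinal, initial_ordinal, ~ countable [set: K]
    & forall C, unbounded C -> [set: K] #<= C].

Definition club C : Prop :=
  unbounded C /\
  forall b, is_limit b ->
    (forall a, (a < b)%O -> exists2 c, C c & (a <= c)%O /\ (c < b)%O) -> C b.

Definition club_class E : set (set K) :=
  [set D | exists2 C, club C & D `&` C = E `&` C].

(* The underlying set and the order of the Boolean algebra B(K). *)
Definition clubB : set (set (set K)) := range club_class.

Definition clubB_le (i j : set (set K)) : Prop :=
  exists D E, [/\ i = club_class D, j = club_class E
                & exists2 C, club C & D `&` C `<=` E].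

End Ordinals.

Arguments is_ordinal {d} K.
Arguments regular_uncountable_cardinal {d} K.
Arguments clubB {d} K.

(* K is isomorphic to an initial segment of K'. *)
Definition ordinal_le (d d' : Order.disp_t) (K : orderType d)
    (K' : orderType d') : Prop :=
  exists f : K -> K',
    (forall a b, (a < b)%O -> (f a < f b)%O) /\
    (forall a y, (y <= f a)%O -> exists b, f b = y).

(* Everything below is stated for left modules over S; right R-modules are
   the case S = R^c, the converse ring of R.                                  *)
Section Submodules.
Variables (S : pzRingType) (M : lmodType S).
Implicit Types U V W X : set M.

Definition submodule U : Prop := submod_closed (mem U).

Definition nonzero_submodule U : Prop := submodule U /\ U <> [set 0].

Definition sum_set V W : set M := [set x + y | x in V & y in W].

Definition indecomposable : Prop :=
  [set: M] <> [set 0] /\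
  forall V W, submodule V -> submodule W ->
    V `&` W = [set 0] -> sum_set V W = [set: M] -> V = [set 0] \/ W = [set 0].

(* U plays the role of the ambient module. *)
Definition complemented_over U W V : Prop :=
  exists X, [/\ submodule X, X `<=` U, W `&` X = V & sum_set W X = U].

Definition cdc (d : Order.disp_t) (K : orderType d) U (c : K -> set M) : Prop :=
  [/\ forall a, nonzero_submodule (c a) /\ c a `<=` U,
      exists2 o, is_zero o & c o = U,
      forall b, is_limit b -> c b = \bigcap_(a in [set a | (a < b)%O]) c a,
      forall a b, is_succ a b -> c b `<` c a
    & forall V, nonzero_submodule V -> V `<=` U -> exists a, c a `<=` V].

Definition strongly_uniform U : Prop :=
  exists (d : Order.disp_t) (K : orderType d) (c : K -> set M),
    is_ordinal K /\ cdc U c.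

Definition has_dimension U (d : Order.disp_t) (K : orderType d) : Prop :=
  [/\ is_ordinal K, exists c : K -> set M, cdc U c
    & forall (d' : Order.disp_t) (K' : orderType d') (c' : K' -> set M),
        is_ordinal K' -> cdc U c' -> ordinal_le K K'].

Section Gamma.
Variables (d : Order.disp_t) (K : orderType d).

Definition Eset U (c : K -> set M) : set K :=
  [set a | exists2 b, (a < b)%O & ~ complemented_over U (c a) (c b)].

(* Gamma(U) = g. The class does not depend on the c.d.c. when K is a regular
   uncountable cardinal, so no c.d.c. is singled out.                         *)
Definition is_Gamma U (g : set (set K)) : Prop :=
  exists2 c : K -> set M, cdc U c & g = club_class (Eset U c).

Definition calG U : set (set (set K)) :=
  [set g | exists V, [/\ nonzero_submodule V, V `<=` U & is_Gamma V g]].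

(* Gamma^*(U) is defined and equal to i. *)
Definition is_Gamma_star U (i : set (set K)) : Prop :=
  calG U i /\ forall g, calG U g -> clubB_le i g.

End Gamma.
End Submodules.

Arguments indecomposable {S} M.

(* Purity: every finite system of linear equations with constants in A that is
   solvable in B is solvable in A.                                            *)
Definition pure_embedding (S : pzRingType) (A B : lmodType S)
    (f : {linear A -> B}) : Prop :=
  injective f /\
  forall (m n : nat) (r : 'M[S]_(m, n)) (a : 'I_m -> A),
    (exists y : 'I_n -> B, forall i, \sum_j r i j *: y j = f (a i)) ->
    exists x : 'I_n -> A, forall i, \sum_j r i j *: x j = a i.

Definition pure_injective (S : pzRingType) (M : lmodType S) : Prop :=
  forall (A B : lmodType S) (f : {linear A -> B}) (g : {linear A -> M}),
    pure_embedding f -> exists h : {linear B -> M}, forall x, h (f x) = g x.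

(* M represents a point of the Ziegler spectrum. *)
Definition in_Zg (S : pzRingType) (M : lmodType S) : Prop :=
  indecomposable M /\ pure_injective M.

(* Main.v *)
From HB Require Import structures.
Require Import Defs.
From mathcomp Require Import all_boot all_order all_algebra.
From mathcomp Require Import finmap monalg.
From mathcomp Require Import boolp classical_sets functions cardinality.
From mathcomp Require Import wochoice.

(* Let R be a free algebra on very many generators. Any F-space U with a set of
   operators is an R-module, and its injective hull I is pure-injective. If U is
   strongly uniform then so is I, with the same small submodules, so that
   Gamma^*(I) = i as soon as Gamma(V) = i for a cofinal family of submodules V
   of U.

   Given i, the class of E, take for U the functions u assigning to each c < kappa
   a "column" u_c in a fixed large space W, such that for all large c the column
   u_c is a copy of the restriction of u to c, via a linear embedding of W^c in W.
   The operators on U act columnwise, except that for c in E column c of the image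
   may also depend on the germ of u at c. A non-zero u has all its large
   columns non-zero, and rank one operators on the columns, continued by the copying
   rule, carry u to any element vanishing below some c; so the
   U_a = {u : u_c = 0 for c < a} form a c.d.c. If a is not in E, then U_a is
   complemented over U_b by {u : u_c = 0 for a <= c < b}. If a is in E, an
   element of U_g that is non-zero at all c in [g, a) can be carried into U_a
   outside U_b, whatever its column at a, so that U_a has no complement over U_b
   in U_g. *)

Set Implicit Arguments.
Unset Strict Implicit.
Unset Printing Implicit Defensive.

Import Order.TTheory GRing.Theory.
Local Open Scope classical_set_scope.
Local Open Scope card_scope.
Local Open Scope ring_scope.

(** * Well-orders and regular cardinals *)

Section WellOrder.
Variables (d : Order.disp_t) (K : orderType d).
Hypothesis Kwo : is_ordinal K.
Implicit Types (a b c : K).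

Lemma wo_min (P : set K) : P !=set0 -> exists2 a, P a & forall b, P b -> (a <= b)%O.
Proof.
move=> [x Px]; have [|z [[Pz zmin] _]] := Kwo (A := [pred y | `[< P y >]]).
  by exists x; apply/asboolP.
exists z; first exact/asboolP.
by move=> b Pb; apply: zmin; apply/asboolP.
Qed.

Lemma wo_ind (P : set K) :
  (forall a, (forall b, (b < a)%O -> P b) -> P a) -> forall a, P a.
Proof.
move=> IH a; apply: contrapT => nPa.
have [|m nPm mmin] := @wo_min (~` P); first by exists a.
apply: nPm; apply: IH => b; rewrite ltNge; apply: contraNP => nPb.
exact: mmin.
Qed.

Lemma wo_wf : well_founded (fun a b => (a < b)%O).
Proof. by apply: wo_ind => a IH; constructor. Qed.

Lemma wo_zero a : exists o : K, is_zero o.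
Proof. by have [|o _ omin] := @wo_min setT; [exists a|exists o => x; exact: omin]. Qed.

Lemma limit_between a b : is_limit b -> (a < b)%O -> exists2 c, (a < c)%O & (c < b)%O.
Proof.
move=> [_ nsucc] ab; apply: contrapT => noc.
apply: (nsucc a); split=> // x ax; rewrite leNgt; apply/negP => xb.
by apply: noc; exists x.
Qed.

Lemma zero_succ_limit b : [\/ is_zero b, exists a, is_succ a b | is_limit b].
Proof.
have [bz|nbz] := pselect (is_zero b); first by constructor 1.
have [bs|nbs] := pselect (exists a, is_succ a b); first by constructor 2.
by constructor 3; split=> // a ab; apply: nbs; exists a.
Qed.

End WellOrder.

(** Transfinite recursion sends [a] to the least element of [K'] not yet hit. If [K'] is never
    exhausted, this embeds [K] onto an initial segment; otherwise a proper initial segment of [K]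
    already covers [K']. The value [y0] is a default for when nothing is left. *)
Lemma wo_compare (d d' : Order.disp_t) (K : orderType d) (K' : orderType d')
    (y0 : K') : is_ordinal K -> is_ordinal K' ->
  ordinal_le K K' \/
  exists (k : K) (h : K -> K'), forall y, exists2 x, (x < k)%O & h x = y.
Proof.
move=> Kwo K'wo.
pose least a (r : forall b : K, (b < a)%O -> K') := xget y0 [set y |
  (forall b h, r b h <> y) /\ forall z, (forall b h, r b h <> z) -> (y <= z)%O].
pose f := Fix (wo_wf Kwo) (fun=> K') least.
have fE a : f a = xget y0 [set y | (forall b, (b < a)%O -> f b <> y) /\
    forall z, (forall b, (b < a)%O -> f b <> z) -> (y <= z)%O].
  rewrite /f Fix_eq // => x r r' rr'.
  by congr (least x _); apply: functional_extensionality_dep => b; apply/funext => h.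
have [[k kfull]|nofull] :=
    pselect (exists k, forall y, exists2 x, (x < k)%O & f x = y).
  by right; exists k, f.
left; exists f.
have fP a : (forall b, (b < a)%O -> f b <> f a) /\
    forall z, (forall b, (b < a)%O -> f b <> z) -> (f a <= z)%O.
  have [|y yP ymin] := @wo_min _ _ K'wo [set y | forall b, (b < a)%O -> f b <> y].
    apply: contrapT => none; apply: nofull; exists a => y.
    apply: contrapT => noy; apply: none; exists y => b ba fby.
    by apply: noy; exists b.
  by rewrite fE; case: xgetP => [z _|/(_ y)[]] //.
split=> [a b ab|a y].
  rewrite lt_neqAle; apply/andP; split; first by apply/eqP; exact: (fP b).1.
  apply: (fP a).2 => c ca; apply: (fP b).1; exact: lt_trans ab.
rewrite le_eqVlt => /orP[/eqP ->|yfa]; first by exists a.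
apply: contrapT => noy; move: yfa; rewrite ltNge => /negP; apply.
by apply: (fP a).2 => b _ fby; apply: noy; exists b.
Qed.

Section Regular.
Variables (d : Order.disp_t) (K : orderType d).
Hypothesis Kreg : regular_uncountable_cardinal K.
Implicit Types (a b c : K).

Let Kwo : is_ordinal K. Proof. by case: Kreg. Qed.

(** An unbounded image would be as large as [K] by regularity, but an image is no larger than
    [A]. *)
Lemma reg_bounded T (A : set T) (f : T -> K) : ~ ([set: K] #<= A) ->
  exists a, forall x, A x -> (f x < a)%O.
Proof.
move=> nA; have [_ _ _ Kunb] := Kreg; apply: contrapT => nob.
apply: nA; apply: card_le_trans (card_image_le f A); apply: Kunb => a.
apply: contrapT => noa; apply: nob; exists a => x Ax.
rewrite ltNge; apply/negP => afx; apply: noa; exists (f x) => //.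
Qed.

Lemma reg_bounded_seg a (f : K -> K) :
  exists b, forall x, (x < a)%O -> (f x < b)%O.
Proof. by apply: (@reg_bounded _ [set x | (x < a)%O]); case: Kreg => _ + _ _; apply. Qed.

Lemma reg_bounded_nat (f : nat -> K) : exists b, forall n, (f n < b)%O.
Proof.
have [|b fb] := @reg_bounded _ [set: nat] f; last by exists b => n; exact: fb.
by case: Kreg.
Qed.

Lemma reg_gt a : exists b, (a < b)%O.
Proof. by have [b ab] := reg_bounded_nat (fun=> a); exists b; exact: (ab 0%N). Qed.

Lemma reg_inhabited : inhabited K.
Proof.
have [_ _ Kunc _] := Kreg; apply: contrapT => K0; apply: Kunc.
have -> : [set: K] = set0 by apply/seteqP; split=> // x _; apply: K0.
exact: countable0.
Qed.

(* Iterate [f] countably often and take the supremum. *)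
Lemma closure_point (f : K -> K) a0 : exists b, [/\ (a0 < b)%O, is_limit b &
  forall a, (a < b)%O -> exists2 a', (a <= a' < b)%O & (f a' < b)%O].
Proof.
have /choice[nxt nxtP] : forall a, exists b, (a < b)%O /\ (f a < b)%O.
  move=> a; have [b] := reg_gt (Order.max a (f a)).
  by rewrite gt_max => /andP[]; exists b.
pose x n := iter n nxt a0.
have [|b xb bmin] := @wo_min _ _ Kwo [set b | forall n, (x n < b)%O].
  by have [b] := reg_bounded_nat x; exists b.
have cof a : (a < b)%O -> exists n, (a <= x n)%O.
  move=> ab; apply: contrapT => non; move: ab; rewrite ltNge => /negP; apply.
  by apply: bmin => n; rewrite ltNge; apply/negP => an; apply: non; exists n.
exists b; split; first exact: (xb 0%N).
  split=> [/(_ a0)|a [ab asucc]]; first by rewrite leNgt (xb 0%N).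
  have [n an] := cof _ ab.
  have := asucc (x n.+1) (le_lt_trans an (nxtP _).1).
  by rewrite leNgt xb.
move=> a /cof[n an]; exists (x n); first by rewrite an xb.
exact: lt_trans (nxtP _).2 (xb n.+1).
Qed.

End Regular.

(** * Modules with a cofinal filtration by submodules *)

Section SubmoduleTheory.
Variables (S : pzRingType) (M : lmodType S).
Implicit Types U V W X : set M.

Lemma submoduleP U : submodule U <->
  U 0 /\ forall a x y, U x -> U y -> U (a *: x + y).
Proof.
split=> [[U0 Ul]|[U0 Ul]].
  split=> [|a x y Ux Uy]; first exact: set_mem U0.
  exact: set_mem (Ul a x y (mem_set Ux) (mem_set Uy)).
split=> [|a x y Ux Uy]; first exact: mem_set U0.
exact: mem_set (Ul a x y (set_mem Ux) (set_mem Uy)).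
Qed.

Lemma submodule_setI U V : submodule U -> submodule V -> submodule (U `&` V).
Proof.
move=> /submoduleP[U0 Ul] /submoduleP[V0 Vl]; apply/submoduleP; split=> //.
by move=> a x y [Ux Vx] [Uy Vy]; split; [apply: Ul|apply: Vl].
Qed.

Lemma submoduleT : submodule [set: M].
Proof. by apply/submoduleP. Qed.

Lemma submoduleD U x y : submodule U -> U x -> U y -> U (x + y).
Proof. by move=> /submoduleP[_ Ul] Ux Uy; rewrite -[x]scale1r; apply: Ul. Qed.

Lemma submoduleZ U a x : submodule U -> U x -> U (a *: x).
Proof. by move=> /submoduleP[U0 Ul] Ux; rewrite -[_ *: _]addr0; apply: Ul. Qed.

Lemma submoduleN U x : submodule U -> U x -> U (- x).
Proof. by move=> sU Ux; rewrite -scaleN1r; apply: submoduleZ. Qed.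

Lemma submoduleB U x y : submodule U -> U x -> U y -> U (x - y).
Proof. by move=> sU Ux Uy; apply: submoduleD => //; apply: submoduleN. Qed.

Lemma nonzero_submoduleP U : nonzero_submodule U <->
  submodule U /\ exists2 x, U x & x <> 0.
Proof.
split=> [[sU nU]|[sU [x Ux nx]]]; last by split=> // U0; apply: nx; move: Ux; rewrite U0.
split=> //; apply: contrapT => no; apply: nU; apply/seteqP; split=> [x Ux|x ->].
  by apply: contrapT => nx; apply: no; exists x.
by have /submoduleP[] := sU.
Qed.

(* Modular law. *)
Lemma complemented_over_sub U U' W V : submodule U' -> U' `<=` U -> W `<=` U' ->
  V `<=` U' -> complemented_over U W V -> complemented_over U' W V.
Proof.
move=> sU' U'U WU' VU' [X [sX XU WX WXU]]; exists (X `&` U'); split.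
- exact: submodule_setI.
- by move=> x [].
- by rewrite setIA WX; apply/setIidPl.
apply/seteqP; split=> [_ [w Ww [x [Xx U'x] <-]]|u U'u].
  by apply: submoduleD => //; apply: WU'.
have : U u by exact: U'U.
rewrite -WXU => -[w Ww [x Xx wxu]]; exists w => //; exists x => //; split=> //.
have -> : x = u - w by rewrite -wxu addrC addKr.
by apply: submoduleB => //; apply: WU'.
Qed.

Section CdcOrder.
Variables (d : Order.disp_t) (K : orderType d) (U : set M) (c : K -> set M).
Hypotheses (Kwo : is_ordinal K) (cU : cdc U c).

Lemma cdc_anti a b : (a <= b)%O -> c b `<=` c a.
Proof.
have [_ _ clim csucc _] := cU.
move: b; apply: (wo_ind Kwo) => b IH; rewrite le_eqVlt => /orP[/eqP -> //|ab].
have [bz|[a' a'b]|bl] := zero_succ_limit b.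
- by have := bz a; rewrite leNgt ab.
- apply: subset_trans (_ : c b `<=` c a') _; first by have [] := csucc _ _ a'b.
  apply: IH; first by case: a'b.
  by rewrite leNgt; apply/negP => a'a; have := a'b.2 _ a'a; rewrite leNgt ab.
by rewrite clim // => x; apply.
Qed.

End CdcOrder.
End SubmoduleTheory.

Section Filtration.
Variables (d : Order.disp_t) (K : orderType d) (S : pzRingType) (M : lmodType S).
Variables (D : K -> set M) (E : set K).
Hypothesis Kreg : regular_uncountable_cardinal K.
Hypothesis D_submodule : forall a, submodule (D a).
Hypothesis D_anti : forall a b, (a <= b)%O -> D b `<=` D a.
Hypothesis D_limit : forall b, is_limit b ->
  \bigcap_(a in [set a | (a < b)%O]) D a `<=` D b.
Hypothesis D_strict : forall a b, (a < b)%O -> D b `<` D a.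
Hypothesis D_cofinal : forall V, nonzero_submodule V -> exists a, D a `<=` V.
(** Complements are asked for only in the first term, since [M] will be a hull of that term. Their
    absence is asked for in every [D g] with [g] below [a], so that it is inherited by every
    non-zero submodule. *)
Hypothesis D_complemented : forall a b, ~ E a -> (a < b)%O ->
  exists2 g, is_zero g & complemented_over (D g) (D a) (D b).
Hypothesis D_not_complemented : forall g a b, E a -> (g < a)%O -> (a < b)%O ->
  ~ complemented_over (D g) (D a) (D b).

Let Kwo : is_ordinal K. Proof. by case: Kreg. Qed.

Lemma filtration_nonzero a : nonzero_submodule (D a).
Proof.
apply/nonzero_submoduleP; split=> //; have [b ab] := reg_gt Kreg a.
have [_ /nonsubset[x [Dax nDbx]]] := D_strict ab; exists x => // x0.
by apply: nDbx; rewrite x0; have /submoduleP[] := D_submodule b.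
Qed.

(** A c.d.c. of [V] must start at [V], which may properly contain the first term of [D]. *)
Definition top_filtration (V : set M) (a : K) := if `[< is_zero a >] then V else D a.

Lemma top_filtration_gt V a b : (a < b)%O -> top_filtration V b = D b.
Proof.
by move=> ab; rewrite /top_filtration; case: asboolP => // /(_ a); rewrite leNgt ab.
Qed.

Lemma cdc_top_filtration (V : set M) (o : K) : is_zero o -> submodule V ->
  D o `<=` V -> cdc V (top_filtration V).
Proof.
move=> oz sV DV.
have DsV a : D a `<=` V by apply: subset_trans DV; apply: D_anti; apply: oz.
have sD a : D a `<=` top_filtration V a.
  by rewrite /top_filtration; case: asboolP => _; [exact: DsV|exact: subset_refl].
split.
- move=> a; rewrite /top_filtration; case: asboolP => az.
    split=> //; apply/nonzero_submoduleP; split=> //.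
    have /nonzero_submoduleP[_ [x Dx nx]] := filtration_nonzero o.
    by exists x => //; apply: DV.
  by split; [exact: filtration_nonzero|].
- by exists o => //; rewrite /top_filtration; case: asboolP.
- move=> b bl; have nbz := bl.1; rewrite {1}/top_filtration; case: asboolP => // _.
  apply/seteqP; split=> [x Dx a ab|x xD].
    by apply: sD; apply: D_anti Dx; apply: ltW.
  apply: D_limit => // a ab; have [c ac cb] := limit_between bl ab.
  by have := xD _ cb; rewrite (top_filtration_gt _ ac); apply: D_anti; apply: ltW.
- move=> a b [ab _]; rewrite (top_filtration_gt _ ab).
  have [Dba nDab] := D_strict ab; split; first exact: subset_trans Dba (sD a).
  by move=> tb; apply: nDab; apply: subset_trans tb.
move=> W nW WV; have [a aW] := D_cofinal nW; have [b ab] := reg_gt Kreg a.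
exists b; rewrite (top_filtration_gt _ ab); apply: subset_trans aW.
by apply: D_anti; apply: ltW.
Qed.

(** Two non-zero submodules both contain some non-zero [D (max a b)]. *)
Lemma filtration_indecomposable : indecomposable M.
Proof.
have [o _] : exists o : K, is_zero o by have [a] := reg_inhabited Kreg; apply: wo_zero a.
have /nonzero_submoduleP[_ [x0 _ nx0]] := filtration_nonzero o.
split=> [T0|V W sV sW VW _]; first by apply: nx0; have : [set: M] x0 by []; rewrite T0.
have [|nV] := pselect (V = [set 0]); [by left|right; apply: contrapT => nW].
have [a aV] := @D_cofinal V (conj sV nV); have [b bW] := @D_cofinal W (conj sW nW).
have /nonzero_submoduleP[_ [x Dx nx]] := filtration_nonzero (Order.max a b).
apply: nx; have : (V `&` W) x; last by rewrite VW.
by split; [apply: aV|apply: bW]; apply: D_anti Dx; rewrite le_max lexx ?orbT.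
Qed.

(** If a proper initial segment of [K] covered the index set of a c.d.c. [c'], regularity would give
    one [D b] inside every [c' y]. For [e] above [b], the strictly smaller [D e] would then contain
    no term of [c']. *)
Lemma filtration_has_dimension : has_dimension [set: M] K.
Proof.
have [o oz] : exists o : K, is_zero o by have [a] := reg_inhabited Kreg; apply: wo_zero a.
split=> //.
  by exists (top_filtration setT); apply: cdc_top_filtration oz (submoduleT M) _.
move=> d' K' c' K'wo cc'; have [c'sub [y0 _ _] _ _ c'cof] := cc'.
have [//|[k [h hsurj]]] := wo_compare y0 Kwo K'wo.
have /choice[g gP] : forall y, exists a, D a `<=` c' y.
  by move=> y; apply: D_cofinal; have [] := c'sub y.
have [b bP] := reg_bounded_seg Kreg k (g \o h).
have [e be] := reg_gt Kreg b.
have [_ nDbe] := D_strict be; exfalso; apply: nDbe.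
have [|y ye] := c'cof (D e) (filtration_nonzero e) _; first by [].
apply: subset_trans ye; have [x xk <-] := hsurj y.
by apply: subset_trans (gP _); apply: D_anti; apply/ltW/bP.
Qed.

Lemma filtration_strongly_uniform : strongly_uniform [set: M].
Proof.
by have [? [c cc] _] := filtration_has_dimension; exists d, K, c.
Qed.

(* [c] and [D] are coinitial in each other, so they have the same intersection
   at every limit point closed under passing back and forth between them. *)
Lemma club_agree (V : set M) (c : K -> set M) (g : K) :
  cdc V c -> D g `<=` V -> club [set a | (g < a)%O /\ c a = D a].
Proof.
move=> cV DV; have [csub _ clim _ ccof] := cV; split=> [a|b bl cofb].
  have /choice[f1 f1P] : forall x, exists y, D y `<=` c x.
    by move=> x; apply: D_cofinal; have [] := csub x.
  have /choice[f2 f2P] : forall x, exists y, c y `<=` D x.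
    move=> x; have [|y ymx] := ccof _ (filtration_nonzero (Order.max g x)).
      by apply: subset_trans DV; apply: D_anti; rewrite le_max lexx.
    by exists y; apply: subset_trans ymx _; apply: D_anti; rewrite le_max lexx orbT.
  have [b [agb bl bP]] := closure_point Kreg
    (fun x => Order.max (f1 x) (f2 x)) (Order.max a g).
  move: agb; rewrite gt_max => /andP[ab gb].
  exists b; last exact: ltW.
  split=> //; apply/seteqP; split=> [x cx|x Dx].
    apply: D_limit => // e eb; have [e' /andP[ee' _]] := bP _ eb.
    rewrite gt_max => /andP[_ f2b]; apply: D_anti ee' _ _; apply: f2P.
    exact: (cdc_anti Kwo cV (ltW f2b)).
  rewrite clim // => e eb; have [e' /andP[ee' _]] := bP _ eb.
  rewrite gt_max => /andP[f1b _]; apply: (cdc_anti Kwo cV ee'); apply: f1P.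
  exact: D_anti (ltW f1b) _ _.
have gb : (g < b)%O.
  have [e eb] : exists e, (e < b)%O.
    apply: contrapT => noe; apply: bl.1 => x; rewrite leNgt; apply/negP => xb.
    by apply: noe; exists x.
  by have [e' [ge' _] [_]] := cofb e eb; apply: lt_trans.
split=> //; apply/seteqP; split=> [x cx|x Dx].
  apply: D_limit => // e eb; have [e' [_ cDe'] [ee' e'b]] := cofb e eb.
  by apply: D_anti ee' _ _; rewrite -cDe'; apply: (cdc_anti Kwo cV (ltW e'b)).
rewrite clim // => e eb; have [e' [_ cDe'] [ee' e'b]] := cofb e eb.
by apply: (cdc_anti Kwo cV ee'); rewrite cDe'; exact: D_anti (ltW e'b) _ _.
Qed.

(** The class of [E] is attained at the first term of [D]. Any other [V] contains some [D g] and has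
    a c.d.c. agreeing with [D] on a club above [g]; there the modular law carries
    non-complementation from [D g] up to [V]. *)
Lemma filtration_Gamma_star : is_Gamma_star [set: M] (club_class E).
Proof.
have [o oz] : exists o : K, is_zero o by have [a] := reg_inhabited Kreg; apply: wo_zero a.
have cDo := cdc_top_filtration oz (D_submodule o) (@subset_refl _ (D o)).
have topE a : top_filtration (D o) a = D a.
  rewrite /top_filtration; case: asboolP => // az.
  by congr D; apply/eqP; rewrite eq_le; apply/andP; split; [exact: oz|exact: az].
rewrite (funext topE) in cDo.
split.
  exists (D o); split=> //; first exact: filtration_nonzero.
  exists D => //.
  (* [D_not_complemented] needs an index below [a], so the two sets are compared only above [o], and
     clubs are cut down accordingly. *)
  have EE : forall a, (o < a)%O -> E a <-> Eset (D o) D a.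
    move=> a oa; split=> [Ea|[b ab nc]].
      by have [b ab] := reg_gt Kreg a; exists b => //; apply: D_not_complemented.
    apply: contrapT => nEa; have [g gz gc] := D_complemented nEa ab.
    have go : g = o.
      by apply/eqP; rewrite eq_le; apply/andP; split; [exact: gz|exact: oz].
    by move: gc; rewrite go.
  have clubo C : club C -> club (C `&` [set a | (o < a)%O]).
    move=> [Cunb Ccl]; split=> [a|b bl cofb].
      have [a' aa'] := reg_gt Kreg a; have [b Cb a'b] := Cunb a'.
      have ab := lt_le_trans aa' a'b; exists b; last exact: ltW.
      by split=> //; apply: le_lt_trans ab; apply: oz.
    split; first by apply: Ccl => // a /cofb[c [Cc _] ac]; exists c.
    have /existsNP[x /negP] := bl.1; rewrite -ltNge => xb.
    by apply: le_lt_trans xb; apply: oz.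
  apply/seteqP; split=> X [C Cclub XC]; exists (C `&` [set a | (o < a)%O]).
  + exact: clubo.
  + rewrite !setIA XC; apply/seteqP; split=> a [[H Ca] oa]; split=> //; split=> //.
      exact/(EE _ oa).
    exact/(EE _ oa).
  + exact: clubo.
  rewrite !setIA XC; apply/seteqP; split=> a [[H Ca] oa]; split=> //; split=> //.
    exact/(EE _ oa).
  exact/(EE _ oa).
move=> _ [V [nV _ [c cV ->]]].
have [g gV] := D_cofinal nV; have Cclub := club_agree cV gV.
exists E, (Eset V c); split=> //; eexists; first exact: Cclub.
move=> a [Ea [ga cDa]]; have [a' aa'] := reg_gt Kreg a.
have [b [gb cDb] a'b] := Cclub.1 a'; have ab := lt_le_trans aa' a'b.
exists b => //; rewrite cDa cDb => VD; apply: (D_not_complemented Ea ga ab).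
by apply: complemented_over_sub VD => //; apply: D_anti; apply: ltW.
Qed.

End Filtration.

(** * Zorn's lemma and linear functionals *)

(** Zorn's lemma is applied to the sets whose union with [N] satisfies [P]; the empty chain is then
    covered by [P N]. *)
Lemma zorn_above (T : Type) (P : set (set T)) (N : set T) : P N ->
  (forall C : set (set T), C !=set0 -> (forall A, C A -> P A) ->
     total_on C subset -> P (\bigcup_(A in C) A)) ->
  exists A, [/\ P A, N `<=` A & forall B, P B -> A `<=` B -> B = A].
Proof.
move=> PN Pchain; have [|A [PA Amax]] := @Zorn_bigcup T [set A | P (A `|` N)].
  move=> C CP Ctot /=; have [->|C0] := eqVneq C set0.
    by rewrite bigcup_set0 set0U.
  have -> : \bigcup_(X in C) X `|` N = \bigcup_(X in (setU^~ N) @` C) X.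
    rewrite bigcup_image; move/set0P: C0 => [X CX]; apply/seteqP; split=> x.
      by case=> [[Y CY Yx]|Nx]; [exists Y => //; left|exists X => //; right].
    by case=> Y CY [Yx|Nx]; [left; exists Y|right].
  apply: Pchain.
  - by move/set0P: C0 => [X CX]; exists (X `|` N); exists X.
  - by move=> _ [X CX <-]; apply: CP.
  move=> _ _ [X CX <-] [Y CY <-].
  by case: (Ctot X Y CX CY) => XY; [left|right]; apply: setSU.
exists (A `|` N); split; [exact: PA|exact: subsetUr|].
move=> B PB ANB; apply: contrapT => nB.
have BN : B `|` N = B by apply/setUidPl; apply: subset_trans ANB; apply: subsetUr.
apply: (Amax B); last by rewrite /= BN.
split; first by apply: subset_trans ANB; apply: subsetUl.
move=> BA; apply: nB; apply/seteqP; split=> // x Bx; left; exact: BA.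
Qed.

Lemma submodule_bigcup (S : pzRingType) (M : lmodType S) (C : set (set M)) :
  C !=set0 -> (forall A, C A -> submodule A) -> total_on C subset ->
  submodule (\bigcup_(A in C) A).
Proof.
move=> [A0 CA0] Csub Ctot; apply/submoduleP; split.
  by exists A0 => //; have /submoduleP[] := Csub _ CA0.
move=> a x y [A CA Ax] [B CB By].
have [AB|BA] := Ctot _ _ CA CB.
  by exists B => //; have /submoduleP[_] := Csub _ CB; apply=> //; apply: AB.
by exists A => //; have /submoduleP[_] := Csub _ CA; apply=> //; apply: BA.
Qed.

Definition adjoin (S : pzRingType) (M : lmodType S) (H : set M) (x : M) : set M :=
  [set y | exists a, H (y - a *: x)].

Lemma submodule_adjoin (S : pzRingType) (M : lmodType S) (H : set M) (x : M) :
  submodule H -> submodule (adjoin H x).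
Proof.
move=> sH; apply/submoduleP; split.
  by exists 0; rewrite scale0r subr0; have /submoduleP[] := sH.
move=> a y z [b Hy] [c Hz]; exists (a * b + c).
have -> : a *: y + z - (a * b + c) *: x = a *: (y - b *: x) + (z - c *: x).
  by rewrite scalerDl scalerBr scalerA opprD addrACA.
by have /submoduleP[_] := sH; apply.
Qed.

Lemma sub_adjoin (S : pzRingType) (M : lmodType S) (H : set M) (x : M) :
  H `<=` adjoin H x.
Proof. by move=> y Hy; exists 0; rewrite scale0r subr0. Qed.

Lemma mem_adjoin (S : pzRingType) (M : lmodType S) (H : set M) (x : M) :
  submodule H -> adjoin H x x.
Proof. by move=> /submoduleP[H0 _]; exists 1; rewrite scale1r subrr. Qed.

Section Functionals.
Variables (F : fieldType) (V : lmodType F).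

Definition functional (f : V -> F) := forall a x y, f (a *: x + y) = a * f x + f y.

Lemma functional0 f : functional f -> f 0 = 0.
Proof.
move=> fl; have := fl 1 0 0; rewrite scale1r addr0 mul1r => /eqP.
by rewrite -subr_eq subrr => /eqP <-.
Qed.

(** A subspace [H] maximal among those containing [N] and avoiding [u] is a hyperplane complementary
    to the line of [u]; [f] reads off the coefficient of [u] modulo [H]. *)
Lemma separating_functional (N : set V) u : submodule N -> ~ N u ->
  exists f, [/\ functional f, forall x, N x -> f x = 0 & f u = 1].
Proof.
move=> sN nNu.
have [||H [[sH nHu] NH Hmax]] := @zorn_above _ [set H | submodule H /\ ~ H u] N.
- by [].
- move=> C C0 CP Ctot; split; first by apply: submodule_bigcup => // A /CP[].
  by move=> [A /CP[]].
have /choice[f fP] : forall x, exists c, H (x - c *: u).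
  move=> x; have [[c Huc]|nH] := pselect (adjoin H x u).
    have [c0|c0] := eqVneq c 0.
      by move: Huc; rewrite c0 scale0r subr0.
    exists c^-1; have -> : x - c^-1 *: u = - c^-1 *: (u - c *: x).
      by rewrite scalerBr scaleNr scalerA mulNr mulVf // !scaleNr scale1r opprK addrC.
    exact: submoduleZ.
  have HE := Hmax _ (conj (submodule_adjoin x sH) nH) (@sub_adjoin _ _ H x).
  by exists 0; rewrite scale0r subr0 -HE; apply: mem_adjoin.
have funiq x c : H (x - c *: u) -> f x = c.
  move=> Hc; apply/eqP; rewrite -subr_eq0; apply/negPn/negP => nz; apply: nHu.
  have -> : u = (f x - c)^-1 *: ((x - c *: u) - (x - f x *: u)).
    have -> : (x - c *: u) - (x - f x *: u) = (f x - c) *: u.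
      by rewrite opprB [LHS]addrC addrA subrK scalerBl.
    by rewrite scalerA mulVf // scale1r.
  by apply: submoduleZ => //; apply: submoduleB.
exists f; split=> [a x y|x Nx|].
- apply: funiq; have -> : a *: x + y - (a * f x + f y) *: u =
    a *: (x - f x *: u) + (y - f y *: u).
    by rewrite scalerDl scalerBr scalerA opprD addrACA.
  by have /submoduleP[_] := sH; apply.
- by apply: funiq; rewrite scale0r subr0; apply: NH.
by apply: funiq; rewrite scale1r subrr; have /submoduleP[] := sH.
Qed.

(** For non-zero [g], separate some [u] with [g u != 0] from the kernel of [g] and rescale by
    [g u]. *)
Lemma functional_extension (P : set V) (g : V -> F) : submodule P ->
  (forall a x y, P x -> P y -> g (a *: x + y) = a * g x + g y) ->
  exists2 h, functional h & forall x, P x -> h x = g x.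
Proof.
move=> sP gl; have /submoduleP[P0 Pl] := sP.
have g0 : g 0 = 0.
  have := gl 1 0 0 P0 P0; rewrite scale1r addr0 mul1r => /eqP.
  by rewrite -subr_eq subrr => /eqP <-.
have gZ a x : P x -> g (a *: x) = a * g x.
  by move=> Px; rewrite -[a *: x]addr0 gl // g0 addr0.
have [[u Pu gu]|nou] := pselect (exists2 u, P u & g u != 0); last first.
  exists (fun=> 0) => [a x y|x Px]; first by rewrite mulr0 addr0.
  by apply/eqP; rewrite eq_sym; apply/negPn/negP => gx; apply: nou; exists x.
have [||f [fl fN fu]] := @separating_functional [set x | P x /\ g x = 0] u.
- apply/submoduleP; split=> // a x y [Px gx] [Py gy]; split; first exact: Pl.
  by rewrite gl // gx gy mulr0 addr0.
- by move=> [_ gu0]; rewrite gu0 eqxx in gu.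
exists (fun x => g u * f x) => [a x y|x Px]; first by rewrite fl mulrDr mulrCA.
have /fN : P (- (g x / g u) *: u + x) /\ g (- (g x / g u) *: u + x) = 0.
  by split; [exact: Pl|rewrite gl // mulNr mulfVK // addNr].
by rewrite fl fu mulr1 => /eqP; rewrite addrC subr_eq0 => /eqP ->; rewrite mulrC mulfVK.
Qed.
End Functionals.

(** * Injective hulls *)

Section SubmoduleType.
Variables (S : pzRingType) (E : lmodType S) (I : set E) (sI : submodule I).

Definition submod_pred of submodule I : {pred E} := mem I.
Definition submod_type := {x : E | x \in submod_pred sI}.

HB.instance Definition _ := [isSub of submod_type for sval].
HB.instance Definition _ := [Choice of submod_type by <:].
HB.instance Definition _ := GRing.isSubmodClosed.Build S E (submod_pred sI)
  (GRing.submod_closed_semi sI).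
HB.instance Definition _ := [SubChoice_isSubLmodule of submod_type by <:].

Lemma submod_valP (x : submod_type) : I (val x).
Proof. exact: set_mem (valP x). Qed.

Lemma submod_lift (x : E) : I x -> exists y : submod_type, val y = x.
Proof. by move=> Ix; exists (Sub x (mem_set Ix)); rewrite SubK. Qed.
End SubmoduleType.

Definition injective_module (S : pzRingType) (E : lmodType S) : Prop :=
  forall (B : lmodType S) (P : set B) (g : B -> E), submodule P ->
    (forall a x y, P x -> P y -> g (a *: x + y) = a *: g x + g y) ->
  exists h : {linear B -> E}, forall x, P x -> h x = g x.

Definition linear_of (S : pzRingType) (A B : lmodType S) (f : A -> B)
    (fl : linear f) : {linear A -> B} :=
  HB.pack f (GRing.isLinear.Build S A B *:%R f fl).

(** Transport [i \o g] to the range of [f], extend it to [B] by injectivity of [E], and return to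
    [M] along [r]. *)
Lemma retract_pure_injective (S : pzRingType) (E M : lmodType S)
    (i : {linear M -> E}) (r : {linear E -> M}) :
  injective_module E -> (forall x, r (i x) = x) -> pure_injective M.
Proof.
move=> Einj ri A B f g [finj _].
have [|a x y [x' _ <-] [y' _ <-]|h hP] :=
    Einj B (range f) (fun b => i (g (xget 0 [set a | f a = b]))).
- apply/submoduleP; split; first by exists 0; rewrite ?linear0.
  by move=> a _ _ [x _ <-] [y _ <-]; exists (a *: x + y); rewrite ?linearP.
- have getf z : xget 0 [set a | f a = f z] = z.
    by case: xgetP => [w _ /finj|/(_ z)[]].
  by rewrite -linearP !getf !linearP.
exists (linear_of (linearP (r \o h))) => x /=.
rewrite hP; last by exists x.
by case: xgetP => [w _ /finj ->|/(_ x)[]].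
Qed.

Section Hull.
Variables (S : pzRingType) (E : lmodType S) (U : set E).
Hypotheses (Einj : injective_module E) (sU : submodule U).

Definition essential_ext (I : set E) := [/\ submodule I, U `<=` I &
  forall x, I x -> x <> 0 -> exists2 a, a *: x <> 0 & U (a *: x)].

Lemma maximal_essential_ext : exists I, essential_ext I /\
  forall J, essential_ext J -> I `<=` J -> J = I.
Proof.
have [||I [eI _ Imax]] := @zorn_above _ essential_ext U.
- split=> // x Ux nx; exists 1; by rewrite scale1r.
- move=> C C0 CP Ctot; split.
  + by apply: submodule_bigcup => // A /CP[].
  + by case: C0 => A CA x Ux; exists A => //; have [_ UA _] := CP _ CA; apply: UA.
  + by move=> x [A CA Ax]; have [_ _] := CP _ CA; apply.
by exists I.
Qed.

(* If h restricts to the identity on I and its kernel is a maximal submodule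
   meeting I trivially, then its image is again essential over U, hence equal
   to I. *)
Lemma essential_ext_retract (I : set E) : essential_ext I ->
  (forall J, essential_ext J -> I `<=` J -> J = I) ->
  exists h : {linear E -> E}, (forall x, I (h x)) /\ forall x, I x -> h x = x.
Proof.
move=> eI Imax; have [sI UI Iess] := eI; have /submoduleP[I0 Il] := sI.
have [||K [[sK KI] _ Kmax]] := @zorn_above _
    [set K | submodule K /\ forall x, K x -> I x -> x = 0] [set 0].
- split=> [|x //]; apply/submoduleP; split=> // a x y -> ->.
  by rewrite scaler0 addr0.
- move=> C C0 CP Ctot; split; first by apply: submodule_bigcup => // A /CP[].
  by move=> x [A CA Ax]; have [_] := CP _ CA; apply.
have /submoduleP[K0 Kl] := sK.
(* The projection of the direct sum of [I] and [K] onto [I]. *)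
pose g x := xget 0 [set i | I i /\ K (x - i)].
have gE x i : I i -> K (x - i) -> g x = i.
  rewrite /g => Ii Ki; case: xgetP => [j _ [Ij Kj]|/(_ i)[]] //.
  apply/eqP; rewrite -subr_eq0; apply/eqP/KI; last exact: submoduleB.
  have -> : j - i = (x - i) - (x - j) by rewrite opprB [RHS]addrC addrA subrK.
  exact: submoduleB.
pose P : set E := [set x | exists2 i, I i & K (x - i)].
have [||h hP] := Einj (P := P) (g := g).
- apply/submoduleP; split; first by exists 0; rewrite ?subr0.
  move=> a x y [i Ii Ki] [j Ij Kj]; exists (a *: i + j); first exact: Il.
  by rewrite opprD addrACA -scalerBr; apply: Kl.
- move=> a x y [i Ii Ki] [j Ij Kj]; rewrite (gE _ _ Ii Ki) (gE _ _ Ij Kj).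
  apply: gE; first exact: Il.
  by rewrite opprD addrACA -scalerBr; apply: Kl.
have hI x : I x -> h x = x.
  by move=> Ix; rewrite hP; [apply: gE|exists x]; rewrite // subrr.
have hK x : K x -> h x = 0.
  by move=> Kx; rewrite hP; [apply: gE|exists 0]; rewrite // subr0.
exists h; split=> // x; rewrite -(Imax (range h)); first by exists x.
  split.
  - apply/submoduleP; split; first by exists 0; rewrite ?linear0.
    by move=> a _ _ [y _ <-] [z _ <-]; exists (a *: y + z); rewrite ?linearP.
  - by move=> y /UI Iy; exists y => //; apply: hI.
  move=> _ [y _ <-] hy0.
  (* Since [h y] is non-zero, [y] is not in [K], so by maximality adjoining [y] to [K] produces a
     non-zero element of [I]; applying [h] identifies it as a multiple of [h y]. *)
  have [z [Iz [a Kz] nz]] : exists z, [/\ I z, adjoin K y z & z <> 0].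
    apply: contrapT => noz; apply: hy0; apply: hK.
    rewrite -(Kmax _ _ (@sub_adjoin _ _ K y)); first exact: mem_adjoin.
    split; first exact: submodule_adjoin.
    by move=> z Kz Iz; apply: contrapT => nz; apply: noz; exists z.
  have zE : z = a *: h y.
    apply/eqP; rewrite -subr_eq0 -{1}(hI _ Iz) -linearZ -linearB.
    by apply/eqP/hK.
  have [b nbz Ubz] := Iess _ Iz nz.
  by exists (b * a); rewrite -scalerA -zE.
by move=> y Iy; exists y => //; apply: hI.
Qed.

(** A maximal essential extension of [U] inside [E] is a retract of [E], hence pure-injective. The
    last clause records essentiality. *)
Lemma injective_hull : exists (I : lmodType S) (i : {linear I -> E}),
  [/\ injective i, forall x, U x -> exists y, i y = x, pure_injective I
    & forall V : set I, nonzero_submodule V ->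
        exists2 x, V x & x <> 0 /\ U (i x)].
Proof.
have [I [eI Imax]] := maximal_essential_ext.
have [h [hI hid]] := essential_ext_retract eI Imax.
have [sI UI Iess] := eI.
pose vali : {linear submod_type sI -> E} := val.
exists (submod_type sI), vali; split.
- exact: val_inj.
- by move=> x /UI /(submod_lift sI).
- pose r x : submod_type sI := Sub (h x) (mem_set (hI x)).
  have rE x : val (r x) = h x by exact: SubK.
  have rl : linear r.
    move=> a x y; apply: val_inj; rewrite [RHS](linearP vali).
    by have := linearP h a x y; rewrite -!rE.
  apply: (@retract_pure_injective _ E _ vali (linear_of rl)) => // x.
  apply: val_inj; rewrite [LHS]rE; apply: hid; exact: submod_valP.
move=> V /nonzero_submoduleP[sV [x Vx nx]].
have [||a nax Uax] := Iess (val x); first exact: submod_valP.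
  by move=> x0; apply: nx; apply: val_inj; rewrite x0 linear0.
exists (a *: x); first exact: submoduleZ.
split; last by rewrite linearZ.
by move=> ax0; apply: nax; rewrite -[RHS](linear0 vali) -ax0 linearZ.
Qed.

End Hull.

(** * Free algebras and coinduced modules *)

Definition free_alg (F : fieldType) (X : choiceType) : Type := {malg F[{fmonom X}]}.

Section FreeAlgebra.
Variables (F : fieldType) (X : choiceType).
HB.instance Definition _ := GRing.Lalgebra.copy (free_alg F X) {malg F[{fmonom X}]}.

Lemma free_alg_scaleAr (k : F) (x y : free_alg F X) : k *: (x * y) = x * (k *: y).
Proof.
rewrite (@malgMEw _ F (msupp x) (msupp y) x (k *: y)) ?msuppZ_le //.
rewrite (@malgME _ F x y) scaler_sumr; apply: eq_bigr => w _.
rewrite scaler_sumr; apply: eq_bigr => v _; apply/malgP => u.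
by rewrite mcoeffZ !mcoeffU mcoeffZ mulrnAr mulrCA.
Qed.

HB.instance Definition _ :=
  GRing.Lalgebra_isAlgebra.Build F (free_alg F X) free_alg_scaleAr.

Definition monomial (w : {fmonom X}) : free_alg F X := << w >>.

Lemma free_algE (r : free_alg F X) : r = \sum_(w <- msupp r) r@_w *: monomial w.
Proof.
rewrite {1}[r]monalgE; apply: eq_bigr => w _; apply/malgP => u.
by rewrite mcoeffZ !mcoeffU mulrnAr mulr1.
Qed.

Lemma monomialM w v : monomial w * monomial v = monomial (mmul w v).
Proof. by rewrite /monomial [LHS]malgM_def fgmulUU mulr1. Qed.

Lemma monomial1 : monomial mone = 1.
Proof. by []. Qed.

End FreeAlgebra.

Section Coinduced.
Variables (F : fieldType) (X : choiceType) (T : Type).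
Local Notation Rc := (free_alg F X)^c.

(* Hom_F(R, T -> F) for the free algebra R: a linear map is a function on words,
   and a generator x acts by f |-> (m |-> f (x m)). *)
Definition coind : Type := {fmonom X} -> T -> F.
HB.instance Definition _ := GRing.Zmodule.copy coind ({fmonom X} -> T -> F).

(** This is (r f)(m) = f(r m) with f extended linearly from words; it reverses products, hence is an
    action of the converse ring. *)
Definition coind_scale (r : Rc) (f : coind) : coind :=
  fun m t => mmap idfun (fun w => f (mmul w m) t) (r : free_alg F X).

Lemma mmapZ_id (h : {fmonom X} -> F) c (r : free_alg F X) :
  mmap idfun h (c *: r) = c * mmap idfun h r.
Proof.
rewrite (mmapEw (msuppZ_le _ _)) mmapE mulr_sumr; apply: eq_bigr => w _.
by rewrite /= mcoeffZ mulrA.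
Qed.

Lemma mmap_monomial (h : {fmonom X} -> F) w : mmap idfun h (monomial F w) = h w.
Proof. by rewrite mmapU mul1r. Qed.

Lemma coind_scaleA a b f : coind_scale a (coind_scale b f) = coind_scale (a * b) f.
Proof.
apply/funext => m; apply/funext => t; rewrite /coind_scale.
have -> : a * b = (b : free_alg F X) * (a : free_alg F X) :> free_alg F X by [].
rewrite [in RHS](free_algE a) mulr_sumr raddf_sum mmapE; apply: eq_bigr => v _.
rewrite -scalerAr [RHS]mmapZ_id; congr (_ * _).
rewrite [in RHS](free_algE b) mulr_suml raddf_sum mmapE; apply: eq_bigr => w _.
by rewrite -scalerAl [RHS]mmapZ_id monomialM mmap_monomial mulmA.
Qed.

Lemma coind_scale1 : left_id 1 coind_scale.
Proof.
move=> f; apply/funext => m; apply/funext => t.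
by rewrite /coind_scale (mmap_monomial _ mone) mul1m.
Qed.

Lemma coind_scaleDr : right_distributive coind_scale +%R.
Proof.
move=> r f g; apply/funext => m; apply/funext => t.
have -> : (coind_scale r f + coind_scale r g) m t =
  coind_scale r f m t + coind_scale r g m t by [].
rewrite /coind_scale !mmapE -big_split /=; apply: eq_bigr => w _.
by rewrite -mulrDr.
Qed.

Lemma coind_scaleDl f : {morph coind_scale^~ f : a b / a + b}.
Proof.
by move=> a b; apply/funext => m; apply/funext => t; rewrite /coind_scale [LHS]mmapD.
Qed.

HB.instance Definition _ := GRing.Zmodule_isLmodule.Build Rc coind
  coind_scaleA coind_scale1 coind_scaleDr coind_scaleDl.

Lemma coind_monomialE w (f : coind) m t :
  ((monomial F w : Rc) *: f) m t = f (mmul w m) t.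
Proof. exact: mmap_monomial. Qed.

Lemma coind_const_monomialE c w (f : coind) m t :
  ((c *: monomial F w : Rc) *: f) m t = c * f (mmul w m) t.
Proof. by rewrite [LHS]mmapZ_id mmap_monomial. Qed.

(** Ring elements are linear combinations of words, and in the converse ring the first letter of a
    word acts first, so induction on the word reduces to generators. *)
Lemma coind_submodule (V : set coind) : V 0 ->
  (forall f g, V f -> V g -> V (f + g)) ->
  (forall c f, V f -> V (fun m t => c * f m t)) ->
  (forall x f, V f -> V (fun m t => f (mmul (fmu x) m) t)) -> submodule V.
Proof.
move=> V0 VD VZ VX; apply/submoduleP; split=> // a f g Vf Vg; apply: (VD) => //.
have Vmon s h : V h -> V ((monomial F (FMonom s) : Rc) *: h).
  elim: s h => [|x s IH] h Vh.
    have -> : (monomial F (FMonom [::]) : Rc) = 1.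
      by have := monomial1 F X; rewrite -[mone]/(fmone X) fmoneE.
    by rewrite scale1r.
  suff -> : FMonom (x :: s) = mmul (fmu x) (FMonom s).
    have -> : monomial F (mmul (fmu x) (FMonom s)) =
      ((monomial F (FMonom s) : Rc) * (monomial F (fmu x) : Rc) : Rc).
      by rewrite -monomialM.
    rewrite -scalerA; apply: IH; have := VX x _ Vh; congr V.
    by apply/funext => m; apply/funext => t; rewrite coind_monomialE.
  by rewrite fmuE; apply/esym/fmmulE.
rewrite (free_algE a) scaler_suml; apply: (big_ind V) => [//||w _]; first exact: VD.
have := VZ a@_w _ (Vmon w _ Vf); rewrite fmK; congr V.
apply/funext => m; apply/funext => t.
by rewrite coind_const_monomialE coind_monomialE.
Qed.

(** * Restriction of scalars and injectivity of coinduced modules *)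

Definition restrict_scalars (B : lmodType Rc) : Type := B.
HB.instance Definition _ (B : lmodType Rc) := GRing.Zmodule.on (restrict_scalars B).

Definition scalar_scale (B : lmodType Rc) (c : F) (b : restrict_scalars B) :
  restrict_scalars B := (c *: (1 : free_alg F X) : Rc) *: (b : B).

Lemma scalar_scaleA B a b f :
  @scalar_scale B a (scalar_scale b f) = scalar_scale (a * b) f.
Proof.
rewrite /scalar_scale scalerA; congr (_ *: _).
rewrite [LHS](_ : _ = (b *: 1 : free_alg F X) * (a *: 1)) //.
by rewrite -scalerAl mul1r scalerA mulrC.
Qed.

Lemma scalar_scale1 B : left_id 1 (@scalar_scale B).
Proof. by move=> f; rewrite /scalar_scale !scale1r. Qed.

Lemma scalar_scaleDr B : right_distributive (@scalar_scale B) +%R.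
Proof. by move=> r f g; rewrite /scalar_scale scalerDr. Qed.

Lemma scalar_scaleDl B f : {morph (@scalar_scale B)^~ f : a b / a + b}.
Proof.
move=> a b; rewrite /scalar_scale -scalerDl; congr (_ *: _); exact: scalerDl.
Qed.

HB.instance Definition _ (B : lmodType Rc) :=
  GRing.Zmodule_isLmodule.Build F (restrict_scalars B)
  (@scalar_scaleA B) (@scalar_scale1 B) (@scalar_scaleDr B) (@scalar_scaleDl B).

(** By the coinduction adjunction, a linear map into [coind] amounts to a family of [F]-functionals,
    its values at the empty word. Each [h t] extends over [F], and the extended map sends [b] to the
    values of [h t] at all multiples of [b] by words. *)
Lemma coind_injective : injective_module coind.
Proof.
move=> B P g sP gl.
have /choice[h hP] : forall t, exists h : restrict_scalars B -> F,
    functional h /\ forall b, P b -> h b = g b mone t.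
  move=> t; pose P' : set (restrict_scalars B) := P.
  have [||h hl hg] :=
    @functional_extension F (restrict_scalars B) P' (fun b => g b mone t).
  - apply/submoduleP; have /submoduleP[P0 Pl] := sP; split=> // c x y; exact: Pl.
  - move=> c x y Px Py; rewrite [c *: x + y]/(_ *: _ + _) gl //.
    have -> : forall f1 f2 : coind, (f1 + f2) mone t = f1 mone t + f2 mone t by [].
    by rewrite -monomial1 coind_const_monomialE mulm1.
  by exists h.
pose k (b : B) : coind := fun m t => h t ((monomial F m : Rc) *: b).
have kl : linear k.
  move=> r b b'; apply/funext => m; apply/funext => t.
  have hD x y : h t (x + y) = h t x + h t y.
    by have := (hP t).1 1 x y; rewrite scale1r mul1r.
  have hZ c x : h t (c *: x) = c * h t x.
    have := (hP t).1 c x 0; rewrite !addr0 => ->.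
    by rewrite functional0 ?addr0 //; have [] := hP t.
  have -> : (r *: k b + k b') m t = (r *: k b) m t + k b' m t by [].
  rewrite {1}/k scalerDr hD; congr (_ + _).
  rewrite [RHS]/GRing.scale /= /coind_scale mmapE scalerA.
  have -> : (monomial F m : Rc) * r = (r : free_alg F X) * monomial F m by [].
  rewrite (free_algE r) mulr_suml scaler_suml (big_morph (h t) hD (functional0 (hP t).1)).
  rewrite -(free_algE r); apply: eq_bigr => w _.
  rewrite -scalerAl monomialM /= /k -hZ; congr (h t _).
  transitivity (((r@_w *: (1 : free_alg F X) : Rc) *
                 (monomial F (mmul w m) : Rc) : Rc) *: b); last by rewrite -scalerA.
  have -> : ((r@_w *: (1 : free_alg F X) : Rc) * (monomial F (mmul w m) : Rc) : Rc) =
    (r@_w *: monomial F (mmul w m) : free_alg F X).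
    by rewrite [LHS](_ : _ = monomial F (mmul w m) * (r@_w *: 1)) // -scalerAr mulr1.
  by [].
exists (linear_of kl) => b Pb; apply/funext => m; apply/funext => t /=.
rewrite /k (hP t).2; last exact: submoduleZ.
have -> : g ((monomial F m : Rc) *: b) = (monomial F m : Rc) *: g b.
  have /submoduleP[P0 _] := sP.
  have g0 : g 0 = 0.
    by have := gl (- 1) _ _ P0 P0; rewrite scaler0 addr0 scaleN1r addNr.
  by have := gl (monomial F m) _ _ Pb P0; rewrite g0 !addr0.
by rewrite coind_monomialE mulm1.
Qed.

End Coinduced.

(** * The space of columns *)

Section FunctionSpace.
Variables (d : Order.disp_t) (K : orderType d) (F : fieldType) (A : set K).
Hypothesis Kreg : regular_uncountable_cardinal K.
Hypothesis A_zero : forall o, is_zero o -> A o.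

(** Columns are functions on finite sequences: putting an index in front of a sequence embeds
    functions on [K * seq K] back into functions on sequences. *)
Definition fn : lmodType F := (K * seq K -> F^o)%type.
Implicit Types (a b c t s : K) (l : seq K) (u v x : fn).

(* Column [c] of [u] is [u (c, _)]. [encode u c] is a single column holding a copy
   of all columns of [u] below [c], and [decode c u] reads it back. *)
Definition encode u c l : F :=
  if l is e :: l' then if (e < c)%O then u (e, l') else 0 else 0.

Definition decode c u : fn := fun p => if (p.1 < c)%O then u (c, p.1 :: p.2) else 0.

Definition canonical_from t u := forall c l, (t <= c)%O -> u (c, l) = encode u c l.

Definition eventually_canonical : set fn := [set u | exists t, canonical_from t u].

Definition zero_on a b u := forall c l, (a <= c <= b)%O -> u (c, l) = 0.

(* For [c] in [A] this says that column [c] is zero; for [c] not in [A] it says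
   moreover that [u] is zero on an interval ending at [c]. *)
Definition vanish c : set fn := [set u | exists2 a, A a & (a <= c)%O /\ zero_on a c u].

(** The last clause at [a] zero keeps levels invariant, and at other [a] in [A] it keeps complements
    invariant. For [c] outside [A], column [c] of the image may still depend on the germ of [u] at
    [c]. *)
Definition good (f : fn -> fn) := [/\ linear f,
  forall u, eventually_canonical u -> eventually_canonical (f u) &
  forall a b u, A a -> (a <= b)%O -> zero_on a b u -> zero_on a b (f u)].

Definition level a : set fn :=
  [set u | eventually_canonical u /\ forall c l, (c < a)%O -> u (c, l) = 0].

(** The canonical continuation of the columns of [y] below [t]. The recursion is on the sequence,
    because copying passes from [(c, e :: l')] to the shorter [(e, l')]. *)
Fixpoint ext t (y : fn) c l : F :=
  if (c < t)%O then y (c, l) else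
  if l is e :: l' then if (e < c)%O then ext t y e l' else 0 else 0.

Definition extend t y : fn := fun p => ext t y p.1 p.2.

Lemma extendE t y c l : (c < t)%O -> extend t y (c, l) = y (c, l).
Proof. by rewrite /extend /=; case: l => [|e l] /= ->. Qed.

Lemma extend_canonical_from t y : canonical_from t (extend t y).
Proof. by move=> c [|e l] tc; rewrite /extend /= ltNge tc. Qed.

Lemma extend_canonical t y : eventually_canonical (extend t y).
Proof. by exists t; apply: extend_canonical_from. Qed.

Lemma canonical_from_le s t u : (s <= t)%O -> canonical_from s u -> canonical_from t u.
Proof. by move=> st su c l tc; apply: su; apply: le_trans tc. Qed.

Lemma canonical_from_eq t u v : canonical_from t u -> canonical_from t v ->
  (forall c l, (c < t)%O -> u (c, l) = v (c, l)) -> u = v.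
Proof.
move=> tu tv uv; apply/funext => -[c l]; elim: l c => [|e l IH] c.
  by have [tc|/uv//] := leP t c; rewrite tu // tv.
by have [tc|/uv//] := leP t c; rewrite tu // tv //= IH.
Qed.

Lemma encodeP k u v c l : encode (k *: u + v) c l = k * encode u c l + encode v c l.
Proof. by case: l => [|e l] /=; [|case: ifP => _]; rewrite ?mulr0 ?addr0. Qed.

Lemma canonical_submodule : submodule eventually_canonical.
Proof.
apply/submoduleP; split.
  have [o] := reg_inhabited Kreg; exists o => c [|e l] _ //=; by case: ifP.
move=> k u v [s su] [t tv]; exists (Order.max s t) => c l.
rewrite ge_max => /andP[sc tc]; rewrite encodeP -su // -tv //.
Qed.

Lemma vanish_submodule c : submodule (vanish c).
Proof.
apply/submoduleP; split.
  have [c0] := reg_inhabited Kreg; have [|o oz] := @wo_zero _ K _ c0; first by case: Kreg.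
  by exists o; [exact: A_zero|split].
(* The larger of the two starting points is one of them, so it lies in [A]. *)
move=> k u v [a Aa [ac ua]] [b Ab [bc vb]]; exists (Order.max a b).
  by rewrite /Order.max; case: ifP.
split; first by rewrite ge_max ac.
move=> e l; rewrite ge_max => /andP[/andP[ae be] ec].
have -> : (k *: u + v) (e, l) = k * u (e, l) + v (e, l) by [].
by rewrite ua ?vb ?mulr0 ?addr0 // ?ae ?be.
Qed.

Lemma level_submodule a : submodule (level a).
Proof.
have /submoduleP[c0 cl] := canonical_submodule.
apply/submoduleP; split=> // k u v [cu u0] [cv v0]; split; first exact: cl.
move=> c l ca; have -> : (k *: u + v) (c, l) = k * u (c, l) + v (c, l) by [].
by rewrite u0 // v0 // mulr0 addr0.
Qed.

(** * Operators prescribed on the columns below a point *)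

Section Act.
Variables (s : K) (g : K -> fn -> F) (v : fn).

(* Below [s] the operator sends column [c] to a multiple of that of [v]; from [s]
   on it is forced by compatibility with [encode]. *)
Fixpoint act_rec u c l {struct l} : F :=
  if (c < s)%O then g c u * v (c, l) else
  if l is e :: l' then if (e < c)%O then act_rec (decode c u) e l' else 0 else 0.

Definition act u : fn := fun p => act_rec u p.1 p.2.

Hypothesis g_functional : forall c, functional (g c).
Hypothesis g_vanish : forall c u, (c < s)%O -> vanish c u -> g c u = 0.

Lemma decodeP c k u w : decode c (k *: u + w) = k *: decode c u + decode c w.
Proof.
apply/funext => -[e l]; rewrite /decode /=.
have -> : forall h1 h2 : fn, (k *: h1 + h2) (e, l) = k * h1 (e, l) + h2 (e, l) by [].
by rewrite /=; case: ifP => _ //; rewrite mulr0 addr0.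
Qed.

Lemma act_recP k u w c l :
  act_rec (k *: u + w) c l = k * act_rec u c l + act_rec w c l.
Proof.
elim: l c u w => [|e l IH] c u w /=; case: ifP => _.
- by rewrite g_functional mulrDl mulrA.
- by rewrite mulr0 addr0.
- by rewrite g_functional mulrDl mulrA.
by case: ifP => _; rewrite ?decodeP ?IH // mulr0 addr0.
Qed.

Lemma act_linear : linear act.
Proof. by move=> k u w; apply/funext => -[c l]; exact: act_recP. Qed.

Lemma act_rec0 c l : act_rec 0 c l = 0.
Proof.
have := act_recP (-1) 0 0 c l; rewrite scaler0 addr0 => ->.
by rewrite mulN1r addNr.
Qed.

Lemma act_vanish u c l : vanish c u -> act_rec u c l = 0.
Proof.
move=> uc; have [cs|sc] := ltP c s.
  by case: l => [|e l] /=; rewrite cs g_vanish // mul0r.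
case: l => [|e l] /=; rewrite ltNge sc //=; case: ifP => // _.
suff -> : decode c u = 0 by exact: act_rec0.
apply/funext => -[x l']; rewrite /decode /=; case: ifP => // _.
by case: uc => a _ [ac]; apply; rewrite ac lexx.
Qed.

(** For [c] beyond [t], [decode c u] and [u] agree on all columns up to [e], so their difference
    vanishes at [e] and [act] does not see it there. *)
Lemma act_canonical_from t u : canonical_from t u ->
  canonical_from (Order.max s t) (act u).
Proof.
move=> tu c l; rewrite ge_max => /andP[sc tc]; rewrite /act /=.
case: l => [|e l] /=; rewrite ltNge sc //=; case: ifP => // ec.
apply/eqP; rewrite -subr_eq0 addrC -mulN1r -act_recP; apply/eqP/act_vanish.
have [|o oz] := @wo_zero _ K _ e; first by case: Kreg.
exists o; first exact: A_zero.
split; first exact: oz.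
move=> x l' /andP[_ xe]; have xc := le_lt_trans xe ec.
have -> : forall h1 h2 : fn, (-1 *: h1 + h2) (x, l') = -1 * h1 (x, l') + h2 (x, l') by [].
by rewrite /decode /= xc (tu c) //= xc mulN1r addNr.
Qed.

Lemma act_good : good act.
Proof.
split; first exact: act_linear.
- by move=> u [t tu]; exists (Order.max s t); apply: act_canonical_from.
move=> a b u Aa ab ua c l /andP[ac cb]; apply: act_vanish.
exists a => //; split=> // e l' /andP[ae ec]; apply: ua.
by rewrite ae (le_trans ec).
Qed.

Lemma actE u c l : (c < s)%O -> act u (c, l) = g c u * v (c, l).
Proof. by move=> cs; rewrite /act /=; case: l => [|e l] /=; rewrite cs. Qed.

End Act.

(** In each column where [x] does not vanish, a functional killing [vanish c] and equal to 1 at [x]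
    serves as the coefficient of [v]; elsewhere the target must be zero. *)
Lemma good_move x s v :
  (forall c l, (c < s)%O -> vanish c x -> v (c, l) = 0) ->
  exists2 f, good f & (forall c l, (c < s)%O -> f x (c, l) = v (c, l)) /\
    forall t, canonical_from t x -> canonical_from (Order.max s t) (f x).
Proof.
move=> vx.
have /choice[g gP] : forall c, exists g : fn -> F, [/\ functional g,
    forall u, vanish c u -> g u = 0 & vanish c x \/ g x = 1].
  move=> c; have [xc|nxc] := pselect (vanish c x).
    by exists (fun=> 0); split=> // [k u w|]; [rewrite mulr0 addr0|left].
  have [g [g1 g2 g3]] := separating_functional (vanish_submodule c) nxc.
  by exists g; split=> //; right.
have gl c : functional (g c) by have [] := gP c.
have gv c u : (c < s)%O -> vanish c u -> g c u = 0.
  by move=> _; have [_ + _] := gP c; apply.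
exists (act s g v); first exact: act_good.
split; last by move=> t; apply: act_canonical_from.
move=> c l cs; rewrite actE //; have [_ _ [xc|->]] := gP c; last by rewrite mul1r.
by rewrite vx // mulr0.
Qed.

(** * Levels, their complements and the obstruction to complements *)

Lemma good_level f a u : good f -> level a u -> level a (f u).
Proof.
move=> [_ fc fz] [cu u0]; split; first exact: fc.
move=> c l ca; have [|o oz] := @wo_zero _ K _ c; first by case: Kreg.
apply: (fz o c u (A_zero oz) (oz c)); last by rewrite oz lexx.
by move=> e l' /andP[_ ec]; apply: u0; apply: le_lt_trans ca.
Qed.

Lemma level_anti a b : (a <= b)%O -> level b `<=` level a.
Proof. by move=> ab u [cu u0]; split=> // c l ca; apply: u0; apply: lt_le_trans ab. Qed.

Lemma level_limit b u : is_limit b -> (forall a, (a < b)%O -> level a u) -> level b u.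
Proof.
move=> bl ub; split.
  have /existsNP[x /negP] := bl.1; rewrite -ltNge => xb; by have [] := ub _ xb.
by move=> c l cb; have [a ca ab] := limit_between bl cb; have [_] := ub _ ab; apply.
Qed.

Lemma level_strict a b : (a < b)%O -> exists2 u, level a u & ~ level b u.
Proof.
move=> ab; pose y : fn := fun p => (p.1 == a)%:R.
exists (extend b y).
  split=> [|c l ca]; first exact: extend_canonical.
  by rewrite extendE ?(lt_trans ca) // /y /= lt_eqF.
move=> [_ /(_ a [::] ab)]; rewrite extendE // /y /= eqxx => /eqP.
by rewrite oner_eq0.
Qed.

(** A non-zero entry of [u] in column [e] is copied into every later column from [t] on, so
    [good_move] reaches any [v] that is zero on the earlier columns. The image and [v] are both
    canonical from [s'] and agree below it, hence coincide. *)
Lemma level_cofinal u : eventually_canonical u -> u <> 0 ->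
  exists a, forall v, level a v -> exists2 f, good f & f u = v.
Proof.
move=> [t tu] nu.
have [[e l] ue] : exists p, u p != 0.
  apply: contrapT => no; apply: nu; apply/funext => p; apply: contrapT => /eqP up.
  by apply: no; exists p.
have [e' ee'] := reg_gt Kreg e.
exists (Order.max t e') => v [[s sv] v0].
pose s' := Order.max s t.
have [|f fgood [fv fc]] := @good_move u s' v.
  move=> c l' _ [a _ [ac uz]]; apply: v0; rewrite ltNge; apply/negP.
  rewrite ge_max => /andP[tc e'c].
  (* By canonicity, the entry of [u] at [(c, e :: l)] is its non-zero entry at [(e, l)]. *)
  move: ue; rewrite -[u _]/(if true then u (e, l) else 0) -{1}(lt_le_trans ee' e'c).
  by rewrite -[X in X != 0]/(encode u c (e :: l)) -tu // uz ?eqxx // ac lexx.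
exists f => //; apply: (@canonical_from_eq s').
- have := fc _ tu; apply: canonical_from_le.
  by rewrite /s' ge_max lexx le_max lexx orbT.
- by apply: canonical_from_le sv; rewrite le_max lexx.
exact: fv.
Qed.

Definition split_complement a b : set fn :=
  [set u | eventually_canonical u /\ forall c l, (a <= c)%O -> (c < b)%O -> u (c, l) = 0].

Lemma split_complement_submodule a b : submodule (split_complement a b).
Proof.
have /submoduleP[c0 cl] := canonical_submodule.
apply/submoduleP; split=> // k u v [cu u0] [cv v0]; split; first exact: cl.
move=> c l ac cb; have -> : (k *: u + v) (c, l) = k * u (c, l) + v (c, l) by [].
by rewrite u0 // v0 // mulr0 addr0.
Qed.

Lemma good_split_complement f a b u : A a -> good f ->
  split_complement a b u -> split_complement a b (f u).
Proof.
move=> Aa [_ fc fz] [cu u0]; split; first exact: fc.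
move=> c l ac cb; apply: (fz a c u Aa ac); last by rewrite ac lexx.
by move=> e l' /andP[ae ec]; apply: u0 => //; apply: le_lt_trans cb.
Qed.

Lemma split_complementI a b u : (a <= b)%O ->
  level a u -> split_complement a b u -> level b u.
Proof.
move=> ab [cu u0] [_ u1]; split=> // c l cb.
by have [ac|ca] := leP a c; [apply: u1|apply: u0].
Qed.

Lemma split_complementD a b u : (a <= b)%O -> eventually_canonical u ->
  exists2 x, split_complement a b x & level a (u - x).
Proof.
(* Keep [u] below [a], put zero on the columns from [a] up to [b], and continue canonically from
   [b]. *)
move=> ab cu; pose x := extend b (fun p => if (p.1 < a)%O then u p else 0).
exists x; first split; first exact: extend_canonical.
  by move=> c l ac cb; rewrite /x extendE //= ltNge ac.
split; first by apply: (submoduleB canonical_submodule cu); apply: extend_canonical.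
move=> c l ca; have -> : (u - x) (c, l) = u (c, l) - x (c, l) by [].
have -> : x (c, l) = u (c, l) by rewrite /x extendE ?(lt_le_trans ca) //= ca.
exact: subrr.
Qed.

(* The obstruction at [a], not in [A]: whatever is congruent modulo [level a]
   to the chosen [u] does not vanish at [a]. *)
Lemma level_obstruction g a b : ~ A a -> (g < a)%O -> (a < b)%O ->
  exists2 u, level g u & forall w, level a w -> eventually_canonical (u - w) ->
    exists2 f, good f & level a (f (u - w)) /\ ~ level b (f (u - w)).
Proof.
move=> nAa ga ab; pose u := extend a (fun p => (g <= p.1)%O%:R).
exists u.
  split=> [|c l cg]; first exact: extend_canonical.
  by rewrite /u extendE ?(lt_trans cg) //= leNgt cg.
move=> w [_ w0] [t tx]; set x := u - w in tx *.
have xa : ~ vanish a x.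
  move=> [r Ar [ra xz]].
  (* As [r] is in [A] and [a] is not, [r] and hence [max r g] lie below [a]; in that column [u] is 1
     and [w] is 0, so [x] is non-zero. *)
  have {}ra : (r < a)%O.
    by rewrite lt_neqAle ra andbT; apply/eqP => rE; apply: nAa; rewrite -rE.
  have ma : (Order.max r g < a)%O by rewrite gt_max ra.
  have := xz (Order.max r g) [::]; rewrite le_max lexx (ltW ma) => /(_ isT).
  have -> : x (Order.max r g, [::]) =
    u (Order.max r g, [::]) - w (Order.max r g, [::]) by [].
  rewrite w0 // /u extendE //= le_max lexx orbT subr0 => /eqP.
  by rewrite oner_eq0.
(* The target lives only in column [a] among those below [b]: it is in [level a] but not in
   [level b]. *)
have [|f fgood [fv fc]] := @good_move x b (fun p => (p.1 == a)%:R).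
  by move=> c l cb xc /=; case: eqP => // ca; case: xa; rewrite -ca.
exists f => //; split.
  split; first by exists (Order.max b t); apply: fc.
  by move=> c l ca; rewrite fv ?(lt_trans ca) //= lt_eqF.
move=> [_ /(_ a [::] ab)]; rewrite fv //= eqxx => /eqP.
by rewrite oner_eq0.
Qed.

End FunctionSpace.

(** * The module *)

Lemma linear_preimage_submodule (S : pzRingType) (M N : lmodType S)
    (i : {linear M -> N}) (V : set N) : submodule V -> submodule (i @^-1` V).
Proof.
move=> /submoduleP[V0 Vl]; apply/submoduleP; split; first by rewrite /= linear0.
by move=> a x y /= Vx Vy; rewrite linearP; apply: Vl.
Qed.

Section Realization.
Variables (d : Order.disp_t) (K : orderType d) (F : fieldType) (E : set K).
Variables (X : choiceType) (opr : X -> fn K F -> fn K F).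
Hypothesis Kreg : regular_uncountable_cardinal K.

(** Zero is always put into [A], even when it is in [E]; this does no harm, as non-complementation
    is claimed only at points above some [g]. *)
Let A : set K := [set a | ~ E a \/ is_zero a].
Hypothesis opr_good : forall x, good A (opr x).
Hypothesis opr_surj : forall f, good A f -> exists x, opr x = f.

Let A_zero o : is_zero o -> A o. Proof. by right. Qed.

Local Notation Rc := (free_alg F X)^c.
Local Notation coindK := (coind F X (K * seq K)%type).

(* Embeds fn K F, with [opr] giving the action of the generators, into the
   injective module [coind]. *)
Definition orbit_map (u : fn K F) : coindK :=
  fun m => foldl (fun v x => opr x v) u (m : seq X).

Lemma orbit_mapP k u v : orbit_map (k *: u + v) =
  (fun m t => k * orbit_map u m t + orbit_map v m t) :> coindK.
Proof.
apply/funext => m; rewrite /orbit_map.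
elim: (m : seq X) u v => [|x s IH] u v //=.
by have [fl _ _] := opr_good x; rewrite fl IH.
Qed.

Lemma orbit_map_shift x u :
  (fun m t => orbit_map u (mmul (fmu x) m) t) = orbit_map (opr x u).
Proof. by apply/funext => m; rewrite /orbit_map fmM fmU. Qed.

Lemma orbit_map_inj : injective orbit_map.
Proof. by move=> u v /(congr1 (fun f => f mone)); rewrite /orbit_map fm1. Qed.

Lemma orbit_map0 : orbit_map 0 = 0.
Proof.
have := orbit_mapP (-1) 0 0; rewrite scaler0 addr0 => ->.
by apply/funext => m; apply/funext => t; rewrite mulN1r addNr.
Qed.

Lemma orbit_mapB u v : orbit_map (u - v) = orbit_map u - orbit_map v.
Proof.
rewrite addrC -scaleN1r orbit_mapP; apply/funext => m; apply/funext => t.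
by rewrite mulN1r addrC.
Qed.

Lemma orbit_map_submodule (W : set (fn K F)) : submodule W ->
  (forall x u, W u -> W (opr x u)) -> submodule (orbit_map @` W : set coindK).
Proof.
move=> /submoduleP[W0 Wl] Wopr; apply: coind_submodule.
- by exists 0 => //; exact: orbit_map0.
- move=> _ _ [u Wu <-] [v Wv <-]; exists (1 *: u + v); first exact: Wl.
  by rewrite orbit_mapP; apply/funext => m; apply/funext => t; rewrite mul1r.
- move=> c _ [u Wu <-]; exists (c *: u + 0); first exact: Wl.
  by rewrite orbit_mapP; apply/funext => m; apply/funext => t; rewrite orbit_map0 addr0.
by move=> x _ [u Wu <-]; exists (opr x u); [exact: Wopr|rewrite orbit_map_shift].
Qed.

Lemma realization : exists I : lmodType Rc,
  [/\ in_Zg I, strongly_uniform [set: I], has_dimension [set: I] K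
    & is_Gamma_star [set: I] (club_class E)].
Proof.
have canopr x u : eventually_canonical u -> eventually_canonical (opr x u).
  by have [_ + _] := opr_good x; apply.
have sU := orbit_map_submodule (canonical_submodule F Kreg) canopr.
have [I [i [i_inj Ui Ipi Iess]]] := injective_hull (@coind_injective F X _) sU.
pose pre (W : set (fn K F)) : set I := i @^-1` (orbit_map @` W).
have lift u : eventually_canonical u -> exists y : I, i y = orbit_map u.
  by move=> cu; apply: Ui; exists u.
(* Each good operator is the action of a generator, so submodules of the hull are stable under all
   of them. *)
have act_mem (V : set I) y u f : submodule V -> V y -> i y = orbit_map u ->
    good A f -> exists2 z, V z & i z = orbit_map (f u).
  move=> sV Vy iy /opr_surj[x <-]; exists ((monomial F (fmu x) : Rc) *: y).
    exact: submoduleZ.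
  rewrite linearZ /= iy -orbit_map_shift; apply/funext => m; apply/funext => t.
  by rewrite coind_monomialE.
pose D a : set I := pre (@level _ K F a).
have sub_pre (W : set (fn K F)) : submodule W ->
    (forall x u, W u -> W (opr x u)) -> submodule (pre W).
  by move=> sW Wopr; apply: linear_preimage_submodule; apply: orbit_map_submodule.
have D_sub a : submodule (D a).
  apply: sub_pre; first exact: level_submodule.
  by move=> x u; apply: (good_level Kreg A_zero (opr_good x)).
have D_anti a b : (a <= b)%O -> D b `<=` D a.
  by move=> ab y [u lu iy]; exists u => //; apply: level_anti lu.
have pre_mem (W : set (fn K F)) y u : i y = orbit_map u -> pre W y -> W u.
  by move=> iy [v Wv]; rewrite iy => /orbit_map_inj <-.
have D_limit b : is_limit b -> \bigcap_(a in [set a | (a < b)%O]) D a `<=` D b.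
  move=> bl y yD; have /existsNP[a /negP] := bl.1; rewrite -ltNge => ab.
  have [u _ iy] := yD _ ab; exists u => //; apply: level_limit bl _ => c cb.
  by apply: (pre_mem _ y u) (yD _ cb).
have D_strict a b : (a < b)%O -> D b `<` D a.
  move=> ab; split; first by apply: D_anti; apply: ltW.
  have [u lu nlu] := level_strict F ab; have [y iy] := lift u lu.1.
  by move=> Dab; apply: nlu; apply: (pre_mem _ y u) => //; apply: Dab; exists u.
have D_cof V : nonzero_submodule V -> exists a, D a `<=` V.
  move=> nV; have [y Vy [ny [u cu iy]]] := Iess V nV.
  have nu : u <> 0.
    by move=> u0; apply: ny; apply: i_inj; rewrite -iy u0 orbit_map0 linear0.
  have [a aP] := level_cofinal Kreg A_zero cu nu; exists a => z [v lv iz].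
  have [f fgood fu] := aP v lv.
  have [z' Vz' iz'] := act_mem V y u f nV.1 Vy (esym iy) fgood.
  by have -> : z = z' by apply: i_inj; rewrite -iz iz' fu.
have D_compl a b : ~ E a -> (a < b)%O ->
    exists2 g, is_zero g & complemented_over (D g) (D a) (D b).
  move=> nEa ab; have [|o oz] := @wo_zero _ K _ a; first by case: Kreg.
  have Aa : A a by left.
  exists o => //; exists (pre (split_complement a b)); split.
  - apply: sub_pre; first exact: split_complement_submodule.
    by move=> x u; apply: (good_split_complement Aa (opr_good x)).
  - move=> y [u [cu _] iy]; exists u => //; split=> // c l.
    by rewrite ltNge oz.
  - apply/seteqP; split=> [y [[u lu iy] Xy]|y [u lu iy]].
      exists u => //; apply: split_complementI (ltW ab) lu _.
      exact: (pre_mem _ y u) Xy.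
    split; exists u => //; first exact: level_anti (ltW ab) _ lu.
    by split; [case: lu|move=> c l _; case: lu => _; apply].
  apply/seteqP; split=> [_ [w Dw [x [u [cu _] ix] <-]]|y [u [cu u0] iy]].
    apply: submoduleD => //; first exact: D_anti (oz a) _ Dw.
    by exists u => //; split=> // c l; rewrite ltNge oz.
  have [x Xx lx] := split_complementD Kreg (ltW ab) cu.
  have [x' ix] := lift x Xx.1; exists (y - x').
    by exists (u - x) => //; rewrite orbit_mapB linearB iy ix.
  by exists x'; [exists x|rewrite subrK].
have D_ncompl g a b : E a -> (g < a)%O -> (a < b)%O ->
    ~ complemented_over (D g) (D a) (D b).
  move=> Ea ga ab [Y [sY YD DYb DYg]].
  have nAa : ~ A a by case=> [//|/(_ g)]; rewrite leNgt ga.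
  have [u lu uP] := level_obstruction F Kreg A_zero nAa ga ab.
  have [y iy] := lift u lu.1.
  have : D g y by exists u.
  (* The component of [y] in a complement [Y] corresponds to [u - w0] with [w0] in [level a]. A
     generator carries it into [D a] outside [D b], yet keeps it in [Y]. *)
  rewrite -DYg => -[w [w0 lw iw] [x Yx wxy]].
  have [x0 [cx0 _] ix] := YD _ Yx.
  have x0E : x0 = u - w0.
    by apply: orbit_map_inj; rewrite orbit_mapB -iy iw ix -wxy linearD addrC addKr.
  have [||f fgood []] := uP w0 _ _; rewrite -?x0E // => lf nlf.
  have [z Yz iz] := act_mem Y x x0 f sY Yx (esym ix) fgood.
  apply: nlf; apply: (pre_mem _ z _ iz).
  by have : (D a `&` Y) z; [split=> //; exists (f x0)|rewrite DYb].
exists I; split.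
- split=> //; exact: filtration_indecomposable Kreg D_sub D_anti D_strict D_cof.
- exact: filtration_strongly_uniform Kreg D_sub D_anti D_limit D_strict D_cof.
- exact: filtration_has_dimension Kreg D_sub D_anti D_limit D_strict D_cof.
exact: filtration_Gamma_star Kreg D_sub D_anti D_limit D_strict D_cof D_compl D_ncompl.
Qed.

End Realization.

(** An injection [q] of [K] into [L] with left inverse [p] conjugates operators on the large space
    to operators on [fn K F]; conjugating back gives a preimage of any [f]. *)
Lemma operator_code (L : Type) (d : Order.disp_t) (K : orderType d) (F : fieldType)
    (k0 : K) : [set: K] #<= [set: L] ->
  exists dec : ((L * seq L -> F) -> (L * seq L -> F)) -> fn K F -> fn K F,
    forall f, exists x, dec x = f.
Proof.
move=> /card_leP[q0]; pose inT (k : K) : [set: K] := exist _ k (mem_set I).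
pose q (k : K) : L := set_val (q0 (inT k)).
have qinj : injective q.
  by move=> x y /val_inj /(@inj _ _ _ q0); rewrite !in_setT => /(_ isT isT) [].
pose p l := xget k0 [set k | q k = l].
have qK : cancel q p.
  by move=> k; rewrite /p; case: xgetP => [k' _ /qinj|/(_ k)[]].
exists (fun x u c => x (fun y => u (p y.1, map p y.2)) (q c.1, map q c.2)) => f.
exists (fun U c => f (fun y => U (q y.1, map q y.2)) (p c.1, map p c.2)).
apply/funext => u; apply/funext => -[c l] /=; rewrite qK mapK //; congr (f _ _).
by apply/funext => -[c' l'] /=; rewrite qK mapK.
Qed.

Theorem theorem4p3 (L : Type) (hL : ~ countable [set: L]) (F : fieldType) :
  exists R : algType F,
    forall (d : Order.disp_t) (K : orderType d),
      regular_uncountable_cardinal K -> [set: K] #<= [set: L] ->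
      forall i : set (set K), clubB K i ->
        exists I : lmodType R^c,
          [/\ in_Zg I,
              strongly_uniform [set: I],
              has_dimension [set: I] K
            & is_Gamma_star [set: I] i].
Proof.
(* The generators are indexed by all operators on a space into which fn K F
   embeds for each admissible K, so that one algebra serves all K and i. *)
exists (free_alg F {classic (L * seq L -> F) -> (L * seq L -> F)}).
move=> d K Kreg KL _ [E _ <-].
have [k0] := reg_inhabited Kreg; have [dec decP] := operator_code F k0 KL.
pose A : set K := [set a | ~ E a \/ is_zero a].
(* Generators whose decoding is not good for this [K] and [E] act as the identity. *)
pose opr x : fn K F -> fn K F := if `[< good A (dec x) >] then dec x else id.
apply: (@realization d K F E _ opr Kreg) => [x|f fgood].
  by rewrite /opr; case: asboolP.
have [x xf] := decP f; exists x; rewrite /opr xf; by case: asboolP.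
Qed.
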